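(* Let $p_1,\ldots,p_r$ be distinct primes (not necessarily in increasing order), and let $\alpha_1,\ldots,\alpha_r$ be positive integers. Suppose that $$\prod_{0<t<s}(\alpha_t+1)\geqslant p_s-[\![r\neq s]\!]\qquad\text{for all } s=1,\ldots,r.$$ Then $p_1^{\alpha_1}\cdots p_r^{\alpha_r}$ is a covering number.
   Context: For $a\in\mathbb{Z}$ and a positive integer $n$, $a(\mathrm{mod}\ n)=\{a+nx: x\in\mathbb{Z}\}$ is the residue class with modulus $n$. A finite system of residue classes $\{a_i(\mathrm{mod}\ n_i)\}_{i=1}^k$ is a cover of $\mathbb{Z}$ if every integer lies in at least one of the classes $a_i(\mathrm{mod}\ n_i)$. A positive integer $n$ is called a covering number if there is a cover of $\mathbb{Z}$ whose moduli are all distinct, greater than one, and divisors of $n$. For a predicate $P$, $[\![P]\!]$ is $1$ if $P$ holds and $0$ otherwise. In $\prod_{0<t<s}$ the index $t$ runs over integers with $0<t<s$; the empty product (case $s=1$) equals $1$. *)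

(* Defs.v *)
From mathcomp Require Import all_boot all_order all_algebra.

Set Implicit Arguments.
Unset Strict Implicit.
Unset Printing Implicit Defensive.

Definition residue_class (a : int) (n : nat) (z : int) : Prop :=
  exists x : int, z = (a + n%:Z * x)%R.

(* A finite system of residue classes is the list of its pairs (a_i, n_i). *)
Definition is_cover (S : seq (int * nat)) : Prop :=
  forall z : int, exists2 c, c \in S & residue_class c.1 c.2 z.

(* Every modulus exceeds 1, so the degenerate "class" of modulus 0 is
   excluded. *)
Definition covering_number (n : nat) : Prop :=
  0 < n /\
  exists S : seq (int * nat),
    [/\ is_cover S,
        uniq [seq c.2 | c <- S],
        forall c, c \in S -> 1 < c.2
      & forall c, c \in S -> c.2 %| n].

(* Main.v *)
(** Process the primes one at a time, keeping a system of classes whose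
    moduli are distinct divisors greater than 1 of the current number M and
    which misses only one class c (mod M).  To pass from M to M p, split the
    missing class into its p subclasses c + i M (mod M p).  A subclass is
    swallowed by the class of c + i M modulo any divisor of M p, so each
    divisor of M p not dividing M disposes of one of them.  If
    M = N p^j with p not dividing N, the products d p^(j+1) with d | N are
    such divisors, and there are as many as divisors of N.  With p - 1 of
    them a single class modulo M p is left over; with p of them nothing is. *)
Require Import Defs.
From mathcomp Require Import all_boot all_order all_algebra.
From mathcomp Require Import zify ring.

Set Implicit Arguments.
Unset Strict Implicit.
Unset Printing Implicit Defensive.

Import GRing.Theory.

Lemma residue_classP (a : int) (n : nat) (z : int) :
  residue_class a n z <-> (n %| (z - a)%R)%Z.
Proof.
split=> [[x ->] | /dvdzP [x zE]].
  by rewrite addrAC subrr add0r dvdz_mulr.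
by exists x; rewrite mulrC -zE addrC subrK.
Qed.

(** The exempt class is kept outside [S], so its modulus [M] may also occur in [S], and [M = 1]
    qualifies with [S] empty. *)
Definition near_cover (M : nat) : Prop :=
  exists (c : int) (S : seq (int * nat)),
    [/\ forall z, residue_class c M z \/
          exists2 s, s \in S & residue_class s.1 s.2 z,
        uniq [seq s.2 | s <- S],
        forall s, s \in S -> 1 < s.2
      & forall s, s \in S -> s.2 %| M].

Lemma residue_class_split (c : int) (M p : nat) (z : int) :
  0 < p -> residue_class c M z ->
  exists2 i, i < p & residue_class (c + Posz (i * M))%R (M * p) z.
Proof.
move=> p_gt0 [x ->]; have pn0 : (Posz p != 0)%R by lia.
(* For [z = c + M x], the remainder of [x] modulo [p] selects the subclass. *)
exists (absz (x %% p)%Z).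
  by have := modz_ge0 x pn0; have := ltz_pmod x (d := Posz p); lia.
exists (x %/ p)%Z; rewrite !PoszM gez0_abs ?modz_ge0 //.
by rewrite {1}(divz_eq x p); ring.
Qed.

(** Leaving the size of [D] free serves both uses: [p - 1] new moduli leave one subclass, [p] leave
    none. *)
Lemma near_cover_refine (M p : nat) (D : seq nat) :
  0 < M -> 0 < p -> near_cover M -> uniq D ->
  (forall n, n \in D -> (n %| M * p) && ~~ (n %| M)) ->
  exists (c : int) (S : seq (int * nat)),
    [/\ forall z,
          (exists2 i, size D <= i < p &
             residue_class (c + Posz (i * M))%R (M * p) z) \/
          exists2 s, s \in S & residue_class s.1 s.2 z,
        uniq [seq s.2 | s <- S],
        forall s, s \in S -> 1 < s.2
      & forall s, s \in S -> s.2 %| M * p].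
Proof.
move=> M_gt0 p_gt0 [c [S [covS uniqS S_gt1 S_dvd]]] uniqD D_new.
(* The [i]-th entry of [D] takes over the [i]-th subclass; [i < size D], so the default 0 is never
   reached. *)
pose T := [seq ((c + Posz (i * M))%R, nth 0 D i) | i <- iota 0 (size D)].
have T2 : [seq s.2 | s <- T] = D by rewrite -map_comp; exact: mkseq_nth.
have TD s : s \in T -> s.2 \in D by move=> sT; rewrite -T2 map_f.
exists c, (S ++ T); split.
- move=> z; case: (covS z) => [cz | [s sS sz]]; last first.
    by right; exists s; rewrite // mem_cat sS.
  have [i ip iz] := residue_class_split p_gt0 cz.
  have [Di | iD] := leqP (size D) i; first by left; exists i; rewrite // Di.
  right; exists ((c + Posz (i * M))%R, nth 0 D i).
    rewrite mem_cat; apply/orP; right.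
    by apply/mapP; exists i; rewrite // mem_iota.
  apply/residue_classP; move/residue_classP: iz; apply: dvdz_trans.
  by have /andP[] := D_new _ (mem_nth 0 iD).
- rewrite map_cat T2 cat_uniq uniqS uniqD andbT /=.
  apply/hasPn => n /D_new /andP[_ nM]; apply: contra nM.
  by case/mapP=> s sS ->; exact: S_dvd.
(* A new modulus is not 0, as it divides [M * p > 0], and not 1, as it does not divide [M]. *)
- move=> s; rewrite mem_cat => /orP[/S_gt1 // | /TD /D_new].
  case: s.2 => [|[|n]] //; last by rewrite !dvd1n.
  by rewrite dvd0n muln_eq0; lia.
- move=> s; rewrite mem_cat => /orP[/S_dvd sM | /TD /D_new /andP[]] //.
  exact: dvdn_mulr.
Qed.

Lemma near_cover_mul (M p : nat) (D : seq nat) :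
  0 < M -> 0 < p -> near_cover M -> uniq D ->
  (forall n, n \in D -> (n %| M * p) && ~~ (n %| M)) ->
  p - 1 <= size D -> near_cover (M * p).
Proof.
move=> M_gt0 p_gt0 ncM uniqD D_new szD.
have [c [S [covS uniqS S_gt1 S_dvd]]] :=
  near_cover_refine M_gt0 p_gt0 ncM uniqD D_new.
(* Only the last index, [p - 1], can satisfy [size D <= i < p]. *)
exists (c + Posz ((p - 1) * M))%R, S; split=> // z.
case: (covS z) => [[i ilt iz] | ]; last by right.
by left; have -> : p - 1 = i by lia.
Qed.

Lemma covering_number_mul (M p : nat) (D : seq nat) :
  0 < M -> 0 < p -> near_cover M -> uniq D ->
  (forall n, n \in D -> (n %| M * p) && ~~ (n %| M)) ->
  p <= size D -> covering_number (M * p).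
Proof.
move=> M_gt0 p_gt0 ncM uniqD D_new szD.
have [c [S [covS uniqS S_gt1 S_dvd]]] :=
  near_cover_refine M_gt0 p_gt0 ncM uniqD D_new.
split; first by rewrite muln_gt0 M_gt0.
exists S; split=> // z; case: (covS z) => // -[i ilt _]; lia.
Qed.

Lemma covering_number_dvd (m n : nat) :
  0 < n -> m %| n -> covering_number m -> covering_number n.
Proof.
move=> n_gt0 mn [_ [S [covS uniqS S_gt1 S_dvd]]]; split=> //.
by exists S; split=> // s /S_dvd sm; exact: dvdn_trans mn.
Qed.

Definition lifted_divisors (N p j : nat) : seq nat :=
  [seq d * p ^ j | d <- divisors N].

Lemma lifted_divisors_uniq (N p j : nat) :
  0 < p -> uniq (lifted_divisors N p j).
Proof.
move=> p_gt0; rewrite map_inj_uniq ?divisors_uniq // => d e /eqP.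
by rewrite eqn_pmul2r ?expn_gt0 ?p_gt0 // => /eqP.
Qed.

(** If [d * p ^ j.+1] divided [N * p ^ j], cancelling [p ^ j] would give [p %| N]. *)
Lemma lifted_divisors_new (N p j n : nat) :
  0 < N -> prime p -> ~~ (p %| N) -> n \in lifted_divisors N p j.+1 ->
  (n %| N * p ^ j * p) && ~~ (n %| N * p ^ j).
Proof.
move=> N_gt0 pr_p pN /mapP[d]; rewrite -dvdn_divisors // => dN ->.
rewrite -mulnA -expnSr dvdn_mul //=; apply: contra pN => dv.
have : p ^ j.+1 %| N * p ^ j by apply: dvdn_trans dv; exact: dvdn_mull.
by rewrite expnS dvdn_pmul2r // expn_gt0 prime_gt0.
Qed.

(** The supply of new moduli is the number of divisors of [N] at every exponent, so one bound serves
    the whole induction on [a]. *)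
Lemma near_cover_primepow (N p a : nat) :
  0 < N -> prime p -> ~~ (p %| N) -> p - 1 <= size (divisors N) ->
  near_cover N -> near_cover (N * p ^ a).
Proof.
move=> N_gt0 pr_p pN szN ncN; have p_gt0 := prime_gt0 pr_p.
elim: a => [|j IHj]; first by rewrite muln1.
rewrite expnSr mulnA.
apply: (near_cover_mul (D := lifted_divisors N p j.+1)) => //.
- by rewrite muln_gt0 N_gt0 expn_gt0 p_gt0.
- exact: lifted_divisors_uniq.
- by move=> n; exact: lifted_divisors_new.
- by rewrite size_map.
Qed.

Lemma covering_number_prime (N p : nat) :
  0 < N -> prime p -> ~~ (p %| N) -> p <= size (divisors N) ->
  near_cover N -> covering_number (N * p).
Proof.
move=> N_gt0 pr_p pN szN ncN; have p_gt0 := prime_gt0 pr_p.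
apply: (covering_number_mul (D := lifted_divisors N p 1)) => //.
- exact: lifted_divisors_uniq.
- by move=> n /lifted_divisors_new; rewrite expn0 muln1; exact.
- by rewrite size_map.
Qed.

(** The products [d * p ^ j] with [d %| N] and [j <= a] are distinct divisors: the [p]-adic
    valuation recovers [j], and then [d]. *)
Lemma size_divisors_primepow (N p a : nat) :
  0 < N -> prime p -> ~~ (p %| N) ->
  size (divisors N) * (a + 1) <= size (divisors (N * p ^ a)).
Proof.
move=> N_gt0 pr_p pN; have p_gt0 := prime_gt0 pr_p.
have logn0 (d : nat) : d \in divisors N -> logn p d = 0.
  rewrite -dvdn_divisors // => dN; apply/eqP; rewrite -leqn0 leqNgt logn_gt0.
  rewrite mem_primes; apply: contra pN => /and3P[_ _ pd].
  exact: dvdn_trans dN.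
have d_gt0 (d : nat) : d \in divisors N -> 0 < d.
  by rewrite -dvdn_divisors // => /dvdn_gt0; exact.
rewrite addn1 -[a.+1](size_iota 0) -(size_allpairs (fun d j => d * p ^ j)).
apply: uniq_leq_size.
  apply: allpairs_uniq; rewrite ?divisors_uniq ?iota_uniq //.
  move=> _ _ /allpairsP[[d i] [dN _ ->]] /allpairsP[[e j] [eN _ ->]] /=.
  move=> de; have ij : i = j.
    have := congr1 (logn p) de.
    by rewrite !lognM ?expn_gt0 ?p_gt0 ?d_gt0 // !pfactorK // !logn0.
  move: de; rewrite ij => /eqP.
  by rewrite eqn_pmul2r ?expn_gt0 ?p_gt0 // => /eqP ->.
move=> _ /allpairsP[[d j] [dN ja ->]].
rewrite -dvdn_divisors ?muln_gt0 ?N_gt0 ?expn_gt0 ?p_gt0 //.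
rewrite dvdn_mul ?dvdn_exp2l //; last by move: ja; rewrite mem_iota; lia.
by rewrite dvdn_divisors.
Qed.

Lemma prod_ord_ltS (r : nat) (F : 'I_r -> nat) (s : 'I_r) :
  \prod_(t < r | t < s.+1) F t = (\prod_(t < r | t < s) F t) * F s.
Proof.
rewrite (bigD1 s) //= mulnC; congr (_ * _); apply: eq_bigl => t.
by rewrite -val_eqE /=; lia.
Qed.

Lemma prime_ndvd_prod (r : nat) (p alpha : 'I_r -> nat) (s : 'I_r) :
  (forall i, prime (p i)) -> injective p ->
  ~~ (p s %| \prod_(t < r | t < s) p t ^ alpha t).
Proof.
move=> p_prime p_inj.
apply: (big_ind (fun n => ~~ (p s %| n))).
- by rewrite dvdn1; case: (p s) (p_prime s) => [|[]].
- by move=> m n sm sn; rewrite Euclid_dvdM // negb_or sm.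
move=> t ts; rewrite Euclid_dvdX // dvdn_prime2 // negb_and.
by apply/orP; left; apply/eqP=> /p_inj st; rewrite st ltnn in ts.
Qed.

(* The index i : 'I_r stands for the 1-based index i.+1, so the Iverson
   bracket [r <> s] reads (r != s.+1), coerced to nat.  The truncated
   subtraction is exact because p s >= 2. *)
Theorem theorem1p1 (r : nat) (p alpha : 'I_r -> nat)
  (r_gt0 : 0 < r)
  (p_prime : forall i : 'I_r, prime (p i))
  (p_inj : injective p)
  (alpha_gt0 : forall i : 'I_r, 0 < alpha i)
  (hprod : forall s : 'I_r,
     \prod_(t < r | t < s) (alpha t + 1) >= p s - (r != s.+1)) :
  covering_number (\prod_(i < r) p i ^ alpha i).
Proof.
pose N m := \prod_(t < r | t < m) p t ^ alpha t.
have N_gt0 m : 0 < N m.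
  by apply: prodn_cond_gt0 => t _; rewrite expn_gt0 prime_gt0.
have pN (s : 'I_r) : ~~ (p s %| N s) by exact: prime_ndvd_prod.
have NS (s : 'I_r) : N s.+1 = N s * p s ^ alpha s by exact: prod_ord_ltS.
(* This turns the products in [hprod] into lower bounds for the supply of new moduli. *)
have tauN m : m <= r ->
    \prod_(t < r | t < m) (alpha t + 1) <= size (divisors (N m)).
  elim: m => [|m IHm] mr; first by rewrite /N !big_pred0.
  pose s := Ordinal mr; rewrite (prod_ord_ltS _ s) (NS s).
  apply: leq_trans (size_divisors_primepow _ (N_gt0 s) (p_prime s) (pN s)).
  by rewrite leq_mul2r IHm ?orbT // ltnW.
have ncN m : m < r -> near_cover (N m).
  elim: m => [|m IHm] mr.
    rewrite /N big_pred0 //; exists 0%R, [::]; split=> // z.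
    by left; apply/residue_classP; exact: dvd1n.
  pose s := Ordinal (ltnW mr); rewrite (NS s).
  apply: near_cover_primepow => //; last by apply: IHm; exact: ltnW.
  apply: leq_trans (tauN s (ltnW (ltn_ord s))); apply: leq_trans (hprod s).
  (* Here [s.+1 < r], so the bracket is 1 and [hprod] supplies exactly the bound [p s - 1]. *)
  by rewrite gtn_eqF.
have rP : r.-1 < r by rewrite prednK.
pose s := Ordinal rP; have sr : s.+1 = r by rewrite /= prednK.
have -> : \prod_(i < r) p i ^ alpha i = N s * p s ^ alpha s.
  by rewrite -NS sr; apply: eq_bigl => t; rewrite ltn_ord.
(* A single factor of the last prime already closes the cover; passing to a multiple restores the
   full power. *)
apply: (@covering_number_dvd (N s * p s)).
- by rewrite muln_gt0 N_gt0 expn_gt0 prime_gt0.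
- by rewrite dvdn_mul // dvdn_exp.
apply: covering_number_prime => //; last exact: ncN.
apply: leq_trans (tauN s (ltnW (ltn_ord s))); apply: leq_trans (hprod s).
(* At the last index the bracket is 0, giving the full bound [p s]. *)
by rewrite sr eqxx subn0.
Qed.
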